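(* Suppose that either $2c_1-j_1c_0$ or $2c_1-j_2c_0$ is equal to $0$. Then for every polynomial $P(x)\in\mathbb R[x]$, there are infinitely many triples $(F_1(x),G_1(x),H_1(x))\in\mathbb R[x]^3$ satisfying $$2\sum_{k=1}^{n}P(k)s_{k-1}=F_1(n)s_{n+1}+G_1(n)s_n+H_1(n)\qquad\text{for all } n\in\mathbb N.$$
   Context: $\mathbb N$ denotes the positive integers. Fix $a,b\in\mathbb N$ and $c_0,c_1\in\mathbb Z$ with $(c_0,c_1)\neq(0,0)$. The generalized Fibonacci sequence $(s_n)_{n\ge0}$ is defined by $s_0=c_0$, $s_1=c_1$, and $s_{n+1}=as_n+bs_{n-1}$ for all $n\in\mathbb N$. Put $j_1=a+\sqrt{a^2+4b}$ and $j_2=a-\sqrt{a^2+4b}$. *)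

(* Defs.v *)
From mathcomp Require Import all_boot all_order all_algebra.
From mathcomp Require Import reals.

Set Implicit Arguments.
Unset Strict Implicit.
Unset Printing Implicit Defensive.

Import GRing.Theory Num.Theory.
Local Open Scope ring_scope.

Fixpoint gfib (a b : nat) (c0 c1 : int) (n : nat) {struct n} : int :=
  match n with
  | 0 => c0
  | 1 => c1
  | (m.+1 as n').+1 => a%:Z * gfib a b c0 c1 n' + b%:Z * gfib a b c0 c1 m
  end.

(* [j1] and [j2] are twice the roots of X^2 - a X - b. *)
Definition j1 (R : realType) (a b : nat) : R :=
  a%:R + Num.sqrt (a%:R ^+ 2 + 4 * b%:R).

Definition j2 (R : realType) (a b : nat) : R :=
  a%:R - Num.sqrt (a%:R ^+ 2 + 4 * b%:R).

(* Main.v *)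
Require Import Defs.
From mathcomp Require Import all_boot all_order all_algebra.
From mathcomp Require Import classical_sets cardinality reals.
From mathcomp Require Import ring lra.

Set Implicit Arguments.
Unset Strict Implicit.
Unset Printing Implicit Defensive.

Import GRing.Theory Num.Theory.
Local Open Scope classical_set_scope.
Local Open Scope ring_scope.

(** Since [2 c1 = j c0] with [r = j / 2] a root of [X^2 - a X - b], the sequence
    is geometric: [s_n = c0 r^n].  As [a + b > 1], [r]
    differs from [1], hence the operator [Q(X) |-> r Q(X+1) - Q(X)]
    is onto, and a preimage [Q] of [P] makes the sum telescope to
    [c0 (Q(n+1) r^n - Q(1))].  The solutions are then infinitely many because
    [s_(n+1) - r s_n = 0], so any constant multiple of this can be added. *)

(** A shift of the variable keeps both the size and the leading coefficient, so the top terms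
    cancel. *)
Lemma size_comp_XaddC_sub (F : idomainType) (c : F) (p : {poly F}) :
  (size (p \Po ('X + c%:P) - p)%R <= (size p).-1)%N.
Proof.
have s2 : size ('X + c%:P) = 2%N by rewrite size_XaddC.
have sE := size_comp_poly2 p s2.
have [p0 | pN0] := eqVneq p 0; first by rewrite p0 comp_poly0 subr0 size_poly0.
apply/leq_sizeP => i; rewrite leq_eqVlt => /orP[/eqP <- | lt_i].
  have := lead_coef_comp p (q := 'X + c%:P).
  rewrite s2 lead_coefXaddC expr1n mulr1 => /(_ isT).
  by rewrite !lead_coefE sE coefB => ->; rewrite subrr.
have le_i : (size p <= i)%N by rewrite (leq_trans (leqSpred _)).
by rewrite coefB !nth_default ?subrr ?sE.
Qed.

(** With [D] the difference [P(X+c) - P], the operator is [(r - 1) + r D]. It sends [P / (r - 1)] to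
    [P] plus the error [r / (r - 1) * D P], which has smaller size, so induction on the size
    corrects it. *)
Lemma scaled_difference_surj (F : fieldType) (r c : F) (P : {poly F}) :
  r != 1 -> exists Q : {poly F}, r *: (Q \Po ('X + c%:P)) - Q = P.
Proof.
move=> r1; have r1' : r - 1 != 0 by rewrite subr_eq0.
have [n le_n] := ubnP (size P).
elim: n P le_n => // n IHn P le_n.
have [-> | PN0] := eqVneq P 0; first by exists 0; rewrite comp_poly0 scaler0 subr0.
have [|Q HQ] := IHn ((r / (r - 1)) *: (P \Po ('X + c%:P) - P)).
  apply: leq_ltn_trans (size_scale_leq _ _) _.
  apply: leq_ltn_trans (size_comp_XaddC_sub _ _) _.
  by rewrite prednK ?size_poly_gt0.
exists ((r - 1)^-1 *: P - Q).
apply/polyP => i; move/polyP/(_ i): HQ.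
rewrite comp_polyB comp_polyZ !(coefB, coefZ).
move: (_`_i) (_`_i) (_`_i) (_`_i) => x y z t /eqP; rewrite subr_eq => /eqP.
by move=> rtE; rewrite mulrBr rtE; field.
Qed.

Local Arguments gfib : simpl never.

Lemma gfib_geometric (R : comNzRingType) (a b : nat) (c0 c1 : int) (r : R) :
  r ^+ 2 = a%:R * r + b%:R -> c1%:~R = r * c0%:~R ->
  forall n, (gfib a b c0 c1 n)%:~R = c0%:~R * r ^+ n.
Proof.
move=> r2 c1E n.
(* The recurrence has order two, so the induction carries two consecutive terms. *)
suff: (gfib a b c0 c1 n)%:~R = c0%:~R * r ^+ n /\
      (gfib a b c0 c1 n.+1)%:~R = c0%:~R * r ^+ n.+1 by case.
elim: n => [|n [IH0 IH1]]; first by rewrite expr0 expr1 mulr1 mulrC.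
split=> //.
have -> : gfib a b c0 c1 n.+2 =
  a%:Z * gfib a b c0 c1 n.+1 + b%:Z * gfib a b c0 c1 n by [].
rewrite intrD !intrM IH0 IH1 -!pmulrn.
by rewrite -addn2 exprD r2 exprS; ring.
Qed.

(** The sign [e] covers [j1 / 2] ([e = 1]) and [j2 / 2] ([e = -1]) at once. *)
Lemma root_half_j (R : realType) (a b : nat) (e : R) :
  e ^+ 2 = 1 ->
  let r := (a%:R + e * Num.sqrt (a%:R ^+ 2 + 4 * b%:R)) / 2 in
  r ^+ 2 = a%:R * r + b%:R.
Proof.
move=> e2 r.
have : Num.sqrt (a%:R ^+ 2 + 4 * b%:R) ^+ 2 = a%:R ^+ 2 + 4 * b%:R :> R.
  by rewrite sqr_sqrtr // addr_ge0 ?sqr_ge0 // mulr_ge0.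
rewrite /r; move: (Num.sqrt _) => t t2; clear r.
have e2t2 : e ^+ 2 * t ^+ 2 = a%:R ^+ 2 + 4 * b%:R by rewrite e2 t2 mul1r.
have -> : ((a%:R + e * t) / 2) ^+ 2
  = (a%:R ^+ 2 + 2 * a%:R * (e * t) + e ^+ 2 * t ^+ 2) / 4 by field.
by rewrite e2t2; field.
Qed.

Lemma sum_poly_geometric (R : comNzRingType) (r : R) (P Q : {poly R}) (n : nat) :
  r *: (Q \Po ('X + 1%:P)) - Q = P ->
  \sum_(1 <= k < n.+1) P.[k%:R] * r ^+ (k - 1)%N
    = Q.[n.+1%:R] * r ^+ n - Q.[1].
Proof.
move=> <-.
rewrite (telescope_sumr_eq (fun k => Q.[k%:R] * r ^+ (k - 1)%N)) //.
  by rewrite subSS subn0 expr0 mulr1.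
(* The range starts at 1, so the truncated exponent at [k = 0] never arises. *)
case=> // k _; rewrite subSS subn0 subn1 /=.
rewrite !(hornerE, horner_comp) natr1 exprS; ring.
Qed.

Theorem theorem3p3 (R : realType) (a b : nat) (c0 c1 : int)
    (a_gt0 : (0 < a)%N) (b_gt0 : (0 < b)%N) (c_neq0 : (c0, c1) <> (0, 0)) :
  2 * c1%:~R - j1 R a b * c0%:~R = 0 \/ 2 * c1%:~R - j2 R a b * c0%:~R = 0 ->
  forall P : {poly R},
  infinite_set [set FGH : {poly R} * {poly R} * {poly R} |
    let: (F1, G1, H1) := FGH in
    forall n : nat, (0 < n)%N ->
      2 * \sum_(1 <= k < n.+1) P.[k%:R] * (gfib a b c0 c1 (k - 1)%N)%:~R
      = F1.[n%:R] * (gfib a b c0 c1 n.+1)%:~R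
        + G1.[n%:R] * (gfib a b c0 c1 n)%:~R + H1.[n%:R]].
Proof.
move=> j_root P.
have [r r2 c1E] : exists2 r : R, r ^+ 2 = a%:R * r + b%:R & c1%:~R = r * c0%:~R.
  case: j_root => jE.
    exists ((a%:R + 1 * Num.sqrt (a%:R ^+ 2 + 4 * b%:R)) / 2).
      by apply: root_half_j; rewrite expr1n.
    by move: jE; rewrite /j1; lra.
  exists ((a%:R + -1 * Num.sqrt (a%:R ^+ 2 + 4 * b%:R)) / 2).
    by apply: root_half_j; rewrite sqrrN expr1n.
  by move: jE; rewrite /j2; lra.
(* The root 1 would force [a + b = 1], while [a] and [b] are both positive. *)
have r1 : r != 1.
  apply/eqP => rE; move: r2; rewrite rE expr1n mulr1 -natrD => /eqP.
  rewrite eq_sym pnatr_eq1 => /eqP ab1.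
  by have := leq_add a_gt0 b_gt0; rewrite ab1.
have [Q QE] := scaled_difference_surj 1 P r1.
have sE := gfib_geometric r2 c1E.
(* The case [m = 0] is the telescoped sum; the parameter [m] adds [m (s_(n+1) - r s_n) = 0]. *)
pose f (m : nat) : {poly R} * {poly R} * {poly R} :=
  (m%:R%:P, 2 *: (Q \Po ('X + 1%:P)) - (m%:R * r)%:P,
   (- (2 * c0%:~R * Q.[1]))%:P).
have f_inj : injective f by move=> m m' [] /polyC_inj /eqP; rewrite eqr_nat => /eqP.
(* Were the solution set finite, its preimage under the injective [f], which is all of [nat], would
   be finite. *)
move=> /(finite_preimage (f := f)) fin_f; apply: infinite_nat.
apply: sub_finite_set (fin_f _) => [m _ n _ /= | m m' _ _]; last exact: f_inj.
under eq_bigr => k _ do rewrite sE mulrCA.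
rewrite -mulr_sumr (sum_poly_geometric _ QE) !sE !(hornerD, hornerN, hornerZ, hornerC, hornerX, horner_comp) natr1.
by rewrite exprS; ring.
Qed.
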